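(* Let $\mu$ be a probability measure on subgraphs of the lattice $\mathbb{Z}^d$ which is supported on single-infinite trees, is translation-invariant and ergodic, and is invariant under rotations by multiples of $\pi/2$ about the coordinate axes. Then there exists a constant $\rho>0$ such that for any vertex $v\in\mathbb{Z}^d$ the following holds. Let $B_n=\{u\in\mathbb{Z}^d:\|u-v\|_\infty\le n\}$, and let $e_n$ be the number of edges of the tree which lie in $B_n$ and lie on a simple path in the tree which connects two boundary points of $B_n$. Then for all large enough $n$, $\mathbb{E}_\mu e_n>\rho n$. Moreover, for $d=2$, $\mathbb{E}_\mu e_n>\rho\, n\log(n)$ for all large enough $n$.
   Context: An infinite tree of bounded degree is called single-infinite if it does not contain two disjoint one-way infinite simple paths. $\mathbb{Z}^d$ is the nearest-neighbour lattice. The boundary points of $B_n$ are the vertices $u$ with $\|u-v\|_\infty=n$. Invariance under rotations means invariance under the rotations of $\mathbb{R}^d$ around the origin by multiples of $\pi/2$ in coordinate planes. *)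

(* Defs.v *)
From HB Require Import structures.
From mathcomp Require Export all_boot all_order all_algebra.
From mathcomp Require Import perm.
From mathcomp Require Export finmap.
From mathcomp Require Export all_classical all_reals all_analysis.

Set Implicit Arguments.
Unset Strict Implicit.
Unset Printing Implicit Defensive.

Import Order.TTheory GRing.Theory Num.Theory.

Local Open Scope classical_set_scope.
Local Open Scope ring_scope.

(* On a row vector x : lattice d, the library norm `|x| is the sup norm. *)
Notation lattice d := 'rV[int]_d.

Section Lattice.
Variable d : nat.
Implicit Types x y v : lattice d.

Definition nearest x y : bool := \sum_(i < d) `|x 0 i - y 0 i| == 1.

Definition box v (n : nat) : set (lattice d) := [set x | `|x - v| <= n%:Z].

Definition box_boundary v (n : nat) : set (lattice d) :=
  [set x | `|x - v| = n%:Z].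

(* For i != j, the rotation by pi/2 in the (i, j) coordinate plane that sends
   the basis vector e_i to e_j and e_j to - e_i; its inverse is
   quarter_turn j i. *)
Definition quarter_turn (i j : 'I_d) x : lattice d :=
  \row_k (if k == i then - x 0 j else if k == j then x 0 i else x 0 k).

Lemma nearest_shift a x y : nearest (shift a x) (shift a y) = nearest x y.
Proof.
rewrite /nearest; congr (_ == _); apply: eq_bigr => i _.
by rewrite !mxE opprD addrACA subrr addr0.
Qed.

Lemma nearest_quarter_turn i j x y :
  nearest (quarter_turn i j x) (quarter_turn i j y) = nearest x y.
Proof.
rewrite /nearest; congr (_ == _).
rewrite [RHS](reindex_inj (@perm_inj _ (tperm i j))) /=.
apply: eq_bigr => k _; rewrite !mxE.
have [->|ki] := eqVneq k i; first by rewrite tpermL -opprD normrN.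
have [->|kj] := eqVneq k j; first by rewrite tpermR.
by rewrite tpermD // eq_sym.
Qed.

Lemma nearest_iter_quarter_turn i j k x y :
  nearest (iter k (quarter_turn i j) x) (iter k (quarter_turn i j) y) =
  nearest x y.
Proof. by elim: k => //= k IHk; rewrite nearest_quarter_turn. Qed.

Record subgraph := Subgraph {
  vset : pred (lattice d);
  adj : rel (lattice d);
  adj_sym : symmetric adj;
  adj_nearest : forall x y, adj x y -> nearest x y;
  adj_vset : forall x y, adj x y -> vset x }.

Definition empty_subgraph : subgraph.
Proof. by exists pred0 (fun _ _ => false). Defined.

HB.instance Definition _ := gen_eqMixin subgraph.
HB.instance Definition _ := gen_choiceMixin subgraph.
HB.instance Definition _ := isPointed.Build subgraph empty_subgraph.

Implicit Type g : subgraph.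

Definition cylinders : set (set subgraph) :=
  [set A | (exists x, A = [set g | vset g x]) \/
           (exists x y, A = [set g | adj g x y])].

(* The preimage of g under f, i.e. its image under the inverse of f when f is
   an automorphism of the lattice. *)
Definition preimage_subgraph (f : lattice d -> lattice d)
  (hf : forall x y, nearest (f x) (f y) = nearest x y) g : subgraph.
Proof.
exists (fun x => vset g (f x)) (fun x y => adj g (f x) (f y)).
- by move=> x y; rewrite adj_sym.
- by move=> x y /adj_nearest; rewrite hf.
- by move=> x y /adj_vset.
Defined.

(* The image of g under x |-> x + a. *)
Definition translate (a : lattice d) g : subgraph :=
  preimage_subgraph (nearest_shift (- a)) g.

(* For i != j, the image of g under the rotation by k * pi/2 from e_i
   towards e_j. *)
Definition rotate (i j : 'I_d) (k : nat) g : subgraph :=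
  preimage_subgraph (nearest_iter_quarter_turn j i k) g.

Definition simple_path g (x : lattice d) (p : seq (lattice d)) : bool :=
  path (adj g) x p && uniq (x :: p).

Definition connected_graph g : Prop :=
  (exists x, vset g x) /\
  forall x y, vset g x -> vset g y ->
    exists2 p, path (adj g) x p & last x p = y.

Definition acyclic g : Prop :=
  forall c, (2 < size c)%N -> ~ ucycle (adj g) c.

Definition tree g : Prop := connected_graph g /\ acyclic g.

Definition bounded_degree g : Prop :=
  exists D : nat, forall x, vset g x -> ([set y | adj g x y] #<= `I_D)%card.

Definition ray g (r : nat -> lattice d) : Prop :=
  injective r /\ forall n, adj g (r n) (r n.+1).

Definition single_infinite_tree g : Prop :=
  [/\ tree g, infinite_set [set x | vset g x], bounded_degree g &
      ~ exists r1 r2, [/\ ray g r1, ray g r2 & range r1 `&` range r2 = set0]].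

(* An edge is represented by the set of its two endpoints. *)
Definition crossing_edges g v (n : nat) : set (set (lattice d)) :=
  [set e | exists x y, [/\ e = [set x; y], adj g x y, box v n x, box v n y &
    exists a p, [/\ simple_path g a p, box_boundary v n a,
      box_boundary v n (last a p) & infix [:: x; y] (a :: p)]]].

(* crossing_edges g v n is finite, since the box is. *)
Definition num_crossing_edges g v (n : nat) : nat :=
  #|` fset_set (crossing_edges g v n)|.

End Lattice.

Notation subgraph_space d := (g_sigma_algebraType (@cylinders d)).

Section Law.
Variables (R : realType) (d : nat) (mu : probability (subgraph_space d) R).

Definition translation_invariant : Prop :=
  forall (a : lattice d) (A : set (subgraph_space d)), measurable A ->
    mu (translate a @^-1` A) = mu A.

Definition ergodic : Prop :=
  forall A : set (subgraph_space d), measurable A ->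
    (forall a : lattice d, translate a @^-1` A = A) ->
    mu A = 0%E \/ mu A = 1%E.

Definition rotation_invariant : Prop :=
  forall (i j : 'I_d) (k : nat) (A : set (subgraph_space d)), i != j ->
    measurable A -> mu (rotate i j k @^-1` A) = mu A.

End Law.

(* Main.v *)
Require Import Defs.
From mathcomp Require Import all_boot all_order all_algebra.
From mathcomp Require Import all_classical all_reals all_analysis.
From mathcomp Require Import measurable_realfun.
From mathcomp Require Import zify lra.

(* Let q > 0 be the probability that the origin lies in the tree.  When it
   does, the tree contains a simple path from 0 to a vertex at distance at
   least 2k + l, and this path meets every sphere of radius k, ..., 2k.  Each
   meeting point x has two disjoint arms in the tree, one reaching distance k
   from x and the other distance l.  Summing over the box of radius 2k,
   translation invariance gives (4k + 1)^d p >= (k + 1) q, where p is the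
   probability that the origin has such a pair of arms.
     If x lies in the interior of B_n and both arms leave B_n, then x is an
   endpoint of a counted edge, so 2 E e_n is at least the sum over such x of
   the probability that they do.  Taking k = l = 2n gives E e_n >= q n / 9^d.
   For d = 2, by rotation invariance an arm of length k goes to the right with
   probability at least p / 4, and at distance j from the right side of B_n it
   suffices to take k = j.  The points at distance j then contribute of order
   n / j each, and the harmonic sum gives n log n. *)

Set Implicit Arguments.
Unset Strict Implicit.
Unset Printing Implicit Defensive.
Import Order.TTheory GRing.Theory Num.Theory.
Local Open Scope classical_set_scope.
Local Open Scope ring_scope.

Lemma uniq_rev_cat (T : eqType) (s t : seq T) :
  uniq (rev s ++ t) = uniq (s ++ t).
Proof. by apply: perm_uniq; rewrite perm_cat2r perm_rev. Qed.

(** * Disjoint arms in lattice subgraphs and the edges they produce *)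

Section Geometry.
Variable d : nat.
Implicit Types (x y v : lattice d) (g : subgraph d).

Lemma lattice_norm_le x (n : nat) :
  `|x| <= n%:Z <-> forall i, `|x 0 i| <= n%:Z.
Proof.
rewrite [ `|x| ]/Num.Def.normr /= mx_normrE; split=> [/bigmax_leP[_ h] i|h].
  exact: (h (0, i)).
by apply/bigmax_leP; split=> // -[a i] _ /=; rewrite (ord1 a).
Qed.

Lemma lattice_norm_ge_coord x i : `|x 0 i| <= `|x|.
Proof.
rewrite [leRHS]/Num.Def.normr /= mx_normrE.
by apply/bigmax_geP; right; exists (0, i).
Qed.

Lemma lattice_norm_geP x (n : nat) : (0 < n)%N ->
  n%:Z <= `|x| <-> exists i, n%:Z <= `|x 0 i|.
Proof.
move=> n0; split=> [nx|[i]]; last first.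
  by move/le_trans; apply; exact: lattice_norm_ge_coord.
apply: contrapT => /forallNP h.
have : `|x| <= n.-1%:Z.
  by apply/lattice_norm_le => i; move/negP: (h i); lia.
by lia.
Qed.

Lemma nearest_norm x y : nearest x y -> `|x - y| <= 1.
Proof.
move=> /eqP h; apply/(lattice_norm_le _ 1) => i; rewrite !mxE -[leRHS]h.
by rewrite (bigD1 i)//= lerDl sumr_ge0.
Qed.

Lemma adj_dist g v x y : adj g x y -> `|y - v| <= `|x - v| + 1.
Proof.
move=> /adj_nearest /nearest_norm; rewrite distrC => h.
by rewrite -(subrKA x y (- v)) addrC (le_trans (ler_normD _ _))// lerD2l.
Qed.

(** The distance to [v] is an integer that grows by at most 1 along an edge, so a path going
    outwards cannot skip a level. *)
Lemma path_meets_sphere g v (n : nat) x p :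
  path (adj g) x p -> `|x - v| <= n%:Z -> n%:Z <= `|last x p - v| ->
  exists q r, p = q ++ r /\ `|last x q - v| = n%:Z.
Proof.
elim: p x => [|y p IHp] x /=.
  by move=> _ h1 h2; exists [::], [::]; split=> //=; apply/le_anti/andP.
move=> /andP[xy yp] xn nl.
have [xvn|xvn] := eqVneq `|x - v| n%:Z; first by exists [::], (y :: p).
have yn : `|y - v| <= n%:Z by have := adj_dist v xy; lia.
by have [q [r [-> qn]]] := IHp _ yp yn nl; exists (y :: q), r.
Qed.

Definition far x (n : nat) : set (lattice d) := [set y | n%:Z <= `|y - x|].

(** The targets are arbitrary sets, so one notion covers arms that reach a distance, a half-plane or
    a prescribed vertex. *)
Definition two_arms g x (Q1 Q2 : set (lattice d)) : Prop :=
  exists p1 p2, [/\ path (adj g) x p1, path (adj g) x p2,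
    uniq (x :: p1 ++ p2), Q1 (last x p1) & Q2 (last x p2)].

Lemma two_arms_sub g x (Q1 Q2 Q1' Q2' : set (lattice d)) :
  Q1 `<=` Q1' -> Q2 `<=` Q2' -> two_arms g x Q1 Q2 -> two_arms g x Q1' Q2'.
Proof.
move=> s1 s2 [p1 [p2 [? ? ? h1 h2]]]; exists p1, p2; split=> //.
  exact: s1.
exact: s2.
Qed.

Lemma rev_path_adj g x p :
  path (adj g) x p -> path (adj g) (last x p) (rev (belast x p)).
Proof. by rewrite rev_path; apply: sub_path => ? ?; rewrite adj_sym. Qed.

(** Cut both arms where they meet the sphere. The first one reversed, followed by the second, is a
    simple path between boundary points, and the first edge of the second arm is a counted edge at
    [x]. *)
Lemma two_arms_crossing g v (n : nat) x (Q1 Q2 : set (lattice d)) :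
  `|x - v| < n%:Z -> Q1 `<=` far v n -> Q2 `<=` far v n ->
  two_arms g x Q1 Q2 -> exists2 e, crossing_edges g v n e & e x.
Proof.
move=> xn Q1n Q2n [p1 [p2 [xp1 xp2 u /Q1n/= l1 /Q2n/= l2]]].
have [q1 [r1 [e1 bq1]]] := path_meets_sphere xp1 (ltW xn) l1.
have [q2 [r2 [e2 bq2]]] := path_meets_sphere xp2 (ltW xn) l2.
move: xp1 xp2 u; rewrite {}e1 {}e2 {l1 l2 p1 p2} !cat_path.
move=> /andP[xq1 _] /andP[xq2 _] u.
have {r1 r2}u : uniq (x :: q1 ++ q2).
  apply: subseq_uniq u; rewrite /= eqxx -catA; apply: cat_subseq => //.
  exact: subseq_trans (prefix_subseq _ _) (suffix_subseq _ _).
(* The second arm has a first edge: it ends on the sphere, while [x] lies strictly inside. *)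
case: q2 => [|y q2] in bq2 xq2 u *; first by rewrite /= in bq2; lia.
have /= /andP[xy yq2] := xq2.
exists [set x; y]; last by left.
exists x, y; split=> //.
- exact: ltW.
- by have := adj_dist v xy;
  change (`|y - v| <= `|x - v| + 1 -> `|y - v| <= n%:Z); lia.
exists (last x q1), (rev (belast x q1) ++ y :: q2).
have E : last x q1 :: rev (belast x q1) ++ y :: q2 = rev (x :: q1) ++ y :: q2.
  by rewrite -cat_cons -rev_rcons -lastI.
have L : last (last x q1) (rev (belast x q1)) = x.
  by case: (q1) => //= a q; rewrite rev_cons last_rcons.
split => //.
- rewrite /simple_path E cat_path L xq2 rev_path_adj //=.
  by rewrite uniq_rev_cat.
- by rewrite last_cat L.
- rewrite E rev_cons cat_rcons; apply/infixP.
  by exists (rev q1), q2.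
Qed.

Lemma two_arms_preimage (f : lattice d -> lattice d)
    (hf : forall x y, nearest (f x) (f y) = nearest x y) g x
    (Q1 Q2 : set (lattice d)) : injective f ->
  two_arms (preimage_subgraph hf g) x (f @^-1` Q1) (f @^-1` Q2) ->
  two_arms g (f x) Q1 Q2.
Proof.
move=> finj [p1 [p2 [h1 h2 u q1 q2]]]; exists (map f p1), (map f p2).
by rewrite !last_map -map_cat -map_cons map_inj_uniq // !path_map.
Qed.

(** Cutting the path where it meets the sphere and reversing the first piece gives one arm back to
    the start and one on to the end. *)
Lemma path_splits_two_arms g v (n : nat) x p :
  path (adj g) x p -> uniq (x :: p) ->
  `|x - v| <= n%:Z -> n%:Z <= `|last x p - v| ->
  exists2 y, `|y - v| = n%:Z & two_arms g y [set x] [set last x p].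
Proof.
move=> xp u xn nl; have [q [r [e qn]]] := path_meets_sphere xp xn nl.
exists (last x q) => //; move: xp u; rewrite {}e cat_path => /andP[xq qr] u.
exists (rev (belast x q)), r; split => //.
- exact: rev_path_adj.
- by rewrite -cat_cons -rev_rcons -lastI uniq_rev_cat.
- by case: (q) => //= a s; rewrite rev_cons last_rcons.
- by rewrite /= last_cat.
Qed.

End Geometry.

(** * Counting in boxes *)

Section Counting.
Variable d : nat.
Implicit Types (x y v : lattice d) (g : subgraph d).

(** Indexing the box of radius [m] around the origin by a finite type gives access to finite sums
    and cardinals. *)
Definition box_point (m : nat) (h : {ffun 'I_d -> 'I_m.*2.+1}) : lattice d :=
  \row_i ((h i)%:Z - m%:Z).

Lemma box_point_inj m : injective (@box_point m).
Proof.
move=> h h' /rowP e; apply/ffunP => i; apply/val_inj.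
by have := e i; rewrite !mxE => /addIr [].
Qed.

Lemma box_point_norm m (h : {ffun 'I_d -> 'I_m.*2.+1}) : `|box_point h| <= m%:Z.
Proof.
by apply/lattice_norm_le => i; rewrite mxE; have := ltn_ord (h i); lia.
Qed.

Lemma box_pointP m x : `|x| <= m%:Z ->
  exists h : {ffun 'I_d -> 'I_m.*2.+1}, x = box_point h.
Proof.
move=> /lattice_norm_le xm; exists [ffun i => inord (absz (x 0 i + m%:Z))].
apply/rowP => i; rewrite mxE ffunE inordK; have := xm i; lia.
Qed.

Lemma finite_box v (n : nat) : finite_set (box v n).
Proof.
apply: (@sub_finite_set _ _ (range (fun h => @box_point n h + v))).
  move=> x /box_pointP [h e]; exists h => //.
  by rewrite -e subrK.
exact: finite_image finite_finset.
Qed.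

Lemma finite_crossing_edges g v n : finite_set (crossing_edges g v n).
Proof.
apply: (@sub_finite_set _ _
  ((fun xy : lattice d * lattice d => [set xy.1; xy.2]) @`
   (box v n `*` box v n))).
  by move=> e [x [y [-> _ xn yn _]]]; exists (x, y).
by apply/finite_image/finite_setX; exact: finite_box.
Qed.

(** Every selected point is an end of some counted edge, and listing both ends of all counted edges
    gives a list of twice their number. *)
Lemma card_le_crossing_edges (I : finType) (f : I -> lattice d) (S : {set I})
    g v n :
  injective f ->
  (forall i, i \in S -> exists2 e, crossing_edges g v n e & e (f i)) ->
  (#|S| <= (num_crossing_edges g v n).*2)%N.
Proof.
move=> f_inj fS; rewrite /num_crossing_edges.
(* Edges are unordered sets, so an ordered pair of ends is chosen for each; sets that are not
   counted edges get the dummy value [(0, 0)]. *)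
have [ends endsP] : {ends : set (lattice d) -> lattice d * lattice d &
    forall e, crossing_edges g v n e -> e = [set (ends e).1; (ends e).2]}.
  apply: (@choice _ _
    (fun e xy => crossing_edges g v n e -> e = [set xy.1; xy.2])) => e.
  have [[x [y [-> _ _ _ _]]]|h] := pselect (crossing_edges g v n e).
    by exists (x, y).
  by exists (0, 0).
set E := fset_set _.
rewrite cardE -(size_map f) -addnn -{1}(size_map (fst \o ends) E).
rewrite -(size_map (snd \o ends) E) -size_cat uniq_leq_size //.
  by rewrite map_inj_uniq // enum_uniq.
move=> y /mapP[i]; rewrite mem_enum => /fS[e eg fie] ->{y}.
have eE : e \in E by rewrite in_fset_set ?inE //; exact: finite_crossing_edges.
move: fie; rewrite (endsP _ eg) mem_cat => -[->|->]; apply/orP; [left|right];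
  exact: map_f.
Qed.

Lemma far_vertex g (n : nat) : infinite_set [set x | vset g x] ->
  exists2 x, vset g x & n%:Z <= `|x|.
Proof.
move=> ginf; apply: contrapT => /forall2NP h; apply: ginf.
apply: sub_finite_set (finite_box 0 n) => x gx.
rewrite /box /= subr0; have [|/negP] := h x => //.
by rewrite -ltNge => /ltW.
Qed.

Lemma many_two_arms g (k l : nat) :
  connected_graph g -> infinite_set [set x | vset g x] -> vset g 0 ->
  (k.+1 <= #|[set h : {ffun 'I_d -> 'I_(k.*2).*2.+1} |
     `[< two_arms g (box_point h)
           (far (box_point h) k) (far (box_point h) l) >]]%SET|)%N.
Proof.
move=> [_ gconn] ginf g0; set S := finset _.
(* At norm [2k + l], the vertex [z] is still at distance at least [l] from every point of norm at
   most [2k]. *)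
have [z gz zfar] := far_vertex (k.*2 + l) ginf.
have [p0 p0P zE] := gconn _ _ g0 gz.
have [p [pP p_uniq pz]] : exists p,
    [/\ path (adj g) 0 p, uniq (0 :: p) & last 0 p = z].
  by rewrite -zE; case: (shortenP p0P) => p *; exists p.
have hS (j : 'I_k.+1) : exists h : {ffun 'I_d -> 'I_(k.*2).*2.+1},
    h \in S /\ `|box_point h| = (k + j)%:Z.
  have [||y yj y2] := @path_splits_two_arms _ _ 0 (k + j) _ _ pP p_uniq.
  - by rewrite subr0 normr0.
  - by rewrite pz subr0; have := ltn_ord j; lia.
  rewrite subr0 in yj.
  have [h yE] := @box_pointP k.*2 y ltac:(have := ltn_ord j; lia).
  exists h; rewrite -yE; split=> //; rewrite inE; apply/asboolP; rewrite -yE.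
  apply: two_arms_sub y2 => _ -> /=.
    by rewrite /far /= sub0r normrN yj; lia.
  rewrite pz /far /=; apply: le_trans (lerB_dist z y).
  by rewrite yj; have := ltn_ord j; lia.
have [H HP] := choice hS.
(* The chosen points lie on spheres of different radii, so they are distinct. *)
have H_inj : injective H.
  move=> i j e; apply: val_inj; have [_] := HP i; have [_] := HP j.
  by rewrite e => -> /eqP; rewrite eqz_nat eqn_add2l => /eqP.
rewrite -[X in (X <= _)%N](card_ord k.+1) -(card_imset _ H_inj).
apply: subset_leq_card.
by apply/fintype.subsetP => _ /imsetP[j _ ->]; have [] := HP j.
Qed.

End Counting.

(** * Measurability of arm events *)

Section Measurability.
Variable d : nat.
Implicit Types (x y v : lattice d).

Lemma measurable_vset x :
  measurable [set g : subgraph_space d | vset (g : subgraph d) x].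
Proof. by apply: sub_sigma_algebra; left; exists x. Qed.

Lemma measurable_path x p :
  measurable [set g : subgraph_space d | path (adj (g : subgraph d)) x p].
Proof.
elim: p x => [|y p IHp] x.
  by rewrite [X in measurable X](_ : _ = setT) //; apply/seteqP; split.
rewrite [X in measurable X](_ : _ =
    [set g : subgraph_space d | adj (g : subgraph d) x y] `&`
    [set g : subgraph_space d | path (adj (g : subgraph d)) y p]).
  by apply: measurableI => //; apply: sub_sigma_algebra; right; exists x, y.
by apply/seteqP; split=> g /= /andP.
Qed.

(** Pairs of finite lists are countable. For a fixed pair, the uniqueness and target conditions do
    not involve the graph, so they cut out everything or nothing. *)
Lemma measurable_two_arms x (Q1 Q2 : set (lattice d)) :
  measurable [set g : subgraph_space d | two_arms (g : subgraph d) x Q1 Q2].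
Proof.
pose F (p : seq (lattice d) * seq (lattice d)) : set (subgraph_space d) :=
  [set g : subgraph_space d | path (adj (g : subgraph d)) x p.1] `&`
  [set g : subgraph_space d | path (adj (g : subgraph d)) x p.2] `&`
  [set _ | [/\ uniq (x :: p.1 ++ p.2), Q1 (last x p.1) & Q2 (last x p.2)]].
rewrite [X in measurable X](_ : _ = \bigcup_p F p).
  apply: countable_bigcupT_measurable => [|p]; first exact: countableP.
  apply: measurableI; first by apply: measurableI; exact: measurable_path.
  have [h|h] := pselect
      [/\ uniq (x :: p.1 ++ p.2), Q1 (last x p.1) & Q2 (last x p.2)].
    by rewrite [X in measurable X](_ : _ = setT) //; apply/seteqP; split.
  by rewrite [X in measurable X](_ : _ = set0) //; apply/seteqP; split.
apply/seteqP; split=> g /=.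
  by move=> [p1 [p2 [h1 h2 h3 h4 h5]]]; exists (p1, p2).
by move=> [[p1 p2] _ [[h1 h2] [h3 h4 h5]]]; exists p1, p2.
Qed.

End Measurability.

(* No measurability is needed because the integral of a nonnegative function is
   the supremum of the integrals of the simple functions below it. *)
Lemma ge0_le_integral_nonmeasurable (disp : measure_display)
    (T : measurableType disp) (R : realType) (mu : {measure set T -> \bar R})
    (f1 f2 : T -> \bar R) :
  (forall x, 0 <= f1 x)%E -> (forall x, f1 x <= f2 x)%E ->
  (\int[mu]_x f1 x <= \int[mu]_x f2 x)%E.
Proof.
move=> f10 f12.
rewrite !ge0_integralTE // => [|x]; last exact: le_trans (f10 x) (f12 x).
apply: ereal_sup_le => _ [h hf <-].
by exists h => // x; exact: le_trans (hf x) (f12 x).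
Qed.

(** * Arm probabilities under translation, and expected edge counts *)

Section Probability.
Variables (R : realType) (d : nat) (mu : probability (subgraph_space d) R).
Implicit Types (x y v : lattice d) (g : subgraph d) (P : set (lattice d)).

(** [P] constrains the displacement from [x], not the end itself, so that translating the graph only
    moves [x]. *)
Definition arm_event P (l : nat) x : set (subgraph_space d) :=
  [set g : subgraph_space d |
    two_arms (g : subgraph d) x [set y | P (y - x)] (far x l)].

Lemma measurable_arm_event P l x : measurable (arm_event P l x).
Proof. exact: measurable_two_arms. Qed.

Lemma sum_measure_indic (I : finType) (c : R)
    (A : I -> set (subgraph_space d)) :
  0 <= c -> (forall i, measurable (A i)) ->
  (\int[mu]_g (\sum_i c * \1_(A i) g)%:E = \sum_i c%:E * mu (A i))%E.
Proof.
move=> c0 mA.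
under eq_integral do rewrite -sumEFin.
rewrite ge0_integral_sum //.
- apply: eq_bigr => i _.
  under eq_integral do rewrite EFinM.
  rewrite ge0_integralZl_EFin //.
  + by rewrite integral_indic// setIT.
  + by apply/measurable_EFinP; exact: measurable_indic.
- move=> j; apply/measurable_EFinP; apply: measurable_funM => //.
- by move=> j g _; rewrite lee_fin mulr_ge0.
Qed.

Lemma sum_indic (I : finType) (A : I -> set (subgraph_space d)) g :
  \sum_i \1_(A i) g = #|[set i | `[< A i g >]]%SET|%:R :> R.
Proof.
rewrite -sum1_card natr_sum [RHS]big_mkcond /=; apply: eq_bigr => i _.
by rewrite indicE inE; case: asboolP => h; [rewrite mem_set|rewrite memNset].
Qed.

(** The factor 1/2 is there because one edge can serve both of its ends. *)
Lemma expectation_crossing_edges_ge (I : finType) (f : I -> lattice d)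
    (A : I -> set (subgraph_space d)) v n :
  injective f -> (forall i, measurable (A i)) ->
  (forall i g, A i g -> exists2 e, crossing_edges g v n e & e (f i)) ->
  (\sum_i (2^-1)%:E * mu (A i) <=
   'E_mu[fun g : subgraph_space d => (num_crossing_edges g v n)%:R])%E.
Proof.
move=> f_inj mA fA; rewrite expectation.unlock -sum_measure_indic //.
apply: ge0_le_integral_nonmeasurable => g.
  by rewrite lee_fin sumr_ge0 // => i _; rewrite mulr_ge0.
rewrite lee_fin -mulr_sumr sum_indic ler_pdivrMl // -natrM ler_nat mul2n.
apply: (card_le_crossing_edges f_inj) => i.
by rewrite inE => /asboolP /fA.
Qed.


(** It suffices to test generators, and the preimage of a cylinder is again a cylinder. *)
Lemma measurable_preimage_subgraph (f : lattice d -> lattice d)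
    (hf : forall x y, nearest (f x) (f y) = nearest x y)
    (A : set (subgraph_space d)) : measurable A ->
  measurable
    ((preimage_subgraph hf : subgraph_space d -> subgraph_space d) @^-1` A).
Proof.
move=> mA; rewrite -[X in measurable X]setTI.
suff : measurable_fun [set: subgraph_space d]
    (preimage_subgraph hf : subgraph_space d -> subgraph_space d) by apply.
apply: (@measurability _ _ (subgraph_space d) (subgraph_space d) setT _
  (@cylinders d)) => // _ [_ [[x ->]|[x [y ->]]] <-]; rewrite setTI;
  apply: sub_sigma_algebra.
- by left; exists (f x).
- by right; exists (f x), (f y).
Qed.

(** Translation by [x - y] takes [y] to [x]: arms of the translated graph at [x] come from arms of
    [g] at [y]. *)
Lemma mu_arm_event_translate P l x y : translation_invariant mu ->
  (mu (arm_event P l x) <= mu (arm_event P l y))%E.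
Proof.
move=> mu_translation; have mx := measurable_arm_event P l x.
rewrite -(mu_translation (x - y)) //; apply: le_measure; rewrite ?inE.
- exact: measurable_preimage_subgraph.
- exact: measurable_arm_event.
have fE (z c : lattice d) : (z + c) - (x + c) = z - x.
  by rewrite opprD addrACA subrr addr0.
have f_inj : injective (shift (- (x - y))) by move=> a b; exact: addIr.
move=> g h; have -> : y = shift (- (x - y)) x.
  by rewrite /shift opprB addrC subrK.
apply: (two_arms_preimage (hf := nearest_shift _)) => //.
by apply: two_arms_sub h => z; rewrite /far /= /shift fE.
Qed.

(** If the origin were almost surely absent, so would be every vertex by translation invariance, and
    the countable union of these null events would leave the graph almost surely empty. *)
Lemma vset_prob_gt0 : translation_invariant mu ->
  {ae mu, forall g, exists x, vset g x} ->
  (0 < mu [set g : subgraph_space d | vset (g : subgraph d) 0%R])%E.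
Proof.
move=> mu_translation mu_nonempty.
set V := fun x => [set g : subgraph_space d | vset (g : subgraph d) x].
rewrite lt_neqAle measure_ge0 andbT; apply/eqP => V0.
have mV x : measurable (V x) by exact: measurable_vset.
have Vx x : mu (V x) = 0%E.
  rewrite -(mu_translation x _ (mV x)) V0; congr (mu _).
  by apply/seteqP; split=> g; rewrite /V /= /shift subrr.
(* [unpickle] numbers the lattice, turning the null events into a sequence; codes of no vertex
   impose nothing. *)
have : {ae mu, forall g, forall k,
    if @unpickle (lattice d) k is Some x then ~ V x g else True}.
  apply: ae_foralln => k; case: unpickle => [x|]; last exact: aeW.
  by exists (V x); split; [exact: mV|exact: Vx|move=> g /contrapT].
have F := ae_filter_ringOfSetsType mu.
move=> mu_empty; have : {ae mu, forall g, False}.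
  apply: filterS2 mu_nonempty mu_empty => g [x gx] /(_ (pickle x)).
  by rewrite pickleK; apply.
move=> [N [mN N0 sN]].
have NT : N = setT by apply/seteqP; split=> // g _; apply: sN => -[].
by move: N0; rewrite NT probability_setT => -[] /eqP; rewrite oner_eq0.
Qed.

(** This integrates the pointwise count [many_two_arms]; [4k + 1] is the side of the box of radius
    [2k]. *)
Lemma arm_event_prob_ge (k l : nat) : translation_invariant mu ->
  {ae mu, forall g, connected_graph g /\ infinite_set [set x | vset g x]} ->
  (k.+1%:R%:E * mu [set g : subgraph_space d | vset (g : subgraph d) 0%R] <=
   ((k.*2).*2.+1 ^ d)%:R%:E * mu (arm_event (far 0%R k) l 0%R))%E.
Proof.
move=> mu_translation mu_conn; set V := [set g | _].
have mV : measurable V by exact: measurable_vset.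
pose I := {ffun 'I_d -> 'I_(k.*2).*2.+1}.
have -> : (((k.*2).*2.+1 ^ d)%:R%:E * mu (arm_event (far 0%R k) l 0%R) =
    \sum_(h : I) mu (arm_event (far 0%R k) l 0%R))%E.
  rewrite -(fineK (fin_num_measure mu _ (measurable_arm_event (far 0 k) l 0))).
  by rewrite sumEFin sumr_const card_ffun !card_ord -EFinM mulr_natl.
apply: (@le_trans _ _ (\sum_(h : I)
    1%:E * mu (arm_event (far 0%R k) l (box_point h)))%E); last first.
  by apply: lee_sum => h _; rewrite mul1e mu_arm_event_translate.
rewrite -sum_measure_indic //; last by move=> h; exact: measurable_arm_event.
have -> : mu V = (\int[mu]_g (\1_V g)%:E)%E by rewrite integral_indic // setIT.
rewrite -ge0_integralZl_EFin //; last first.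
  by apply/measurable_EFinP; exact: measurable_indic.
apply: ae_ge0_le_integral => //.
- apply: emeasurable_funM => //; apply/measurable_EFinP.
  exact: measurable_indic.
- by move=> g _; rewrite lee_fin sumr_ge0 // => h _; rewrite mulr_ge0.
- apply/measurable_EFinP; apply: measurable_sum => h.
  apply: measurable_funM => //; apply: measurable_indic.
  exact: measurable_arm_event.
have F := ae_filter_ringOfSetsType mu.
apply: filterS mu_conn => g [gconn ginf] _.
rewrite -EFinM lee_fin -mulr_sumr mul1r sum_indic indicE.
have [/set_mem g0|_] := boolP (g \in V); last by rewrite mulr0.
rewrite mulr1 ler_nat; apply: leq_trans (many_two_arms k l gconn ginf g0) _.
apply/subset_leq_card/fintype.subsetP => h; rewrite !inE => h2.
rewrite /arm_event /=; apply: two_arms_sub h2 => // y;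
  by rewrite /far /= subr0.
Qed.

End Probability.

(** * Rotations and arms ending in a half-plane *)

Section Rotation.
Variable d : nat.
Implicit Types (x y v : lattice d) (i j : 'I_d).

Lemma quarter_turn0 i j : quarter_turn i j 0 = 0.
Proof. by apply/rowP => k; rewrite !mxE oppr0 !if_same. Qed.

Lemma quarter_turn_inj i j : i != j -> injective (quarter_turn i j).
Proof.
move=> ij x y /rowP e; apply/rowP => k.
have [->|ki] := eqVneq k i.
  by have := e j; rewrite !mxE eqxx eq_sym (negPf ij).
have [->|kj] := eqVneq k j.
  by have := e i; rewrite !mxE eqxx => /oppr_inj.
by have := e k; rewrite !mxE (negPf ki) (negPf kj).
Qed.

Lemma quarter_turn_norm_ge i j x : i != j -> `|x| <= `|quarter_turn i j x|.
Proof.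
move=> ij; have [n En] : exists n : nat, `|quarter_turn i j x| = n%:Z.
  by exists (absz `|quarter_turn i j x|); rewrite gez0_abs.
have hn := lattice_norm_ge_coord (quarter_turn i j x).
rewrite En in hn *; apply/lattice_norm_le => k.
have [->|ki] := eqVneq k i.
  by have := hn j; rewrite !mxE eqxx eq_sym (negPf ij).
have [->|kj] := eqVneq k j.
  by have := hn i; rewrite !mxE eqxx normrN.
by have := hn k; rewrite !mxE (negPf ki) (negPf kj).
Qed.

(** A quarter turn fixes the origin and does not shorten vectors, so it moves the target of the
    first arm and keeps the second arm far. *)
Lemma mu_arm_event_rotate (R : realType) (mu : probability (subgraph_space d) R)
    (P : set (lattice d)) (l : nat) i j : rotation_invariant mu -> i != j ->
  (mu (arm_event (quarter_turn j i @^-1` P) l 0%R) <= mu (arm_event P l 0%R))%E.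
Proof.
move=> mu_rotation ij; have ji : j != i by rewrite eq_sym.
have mA := measurable_arm_event (quarter_turn j i @^-1` P) l 0.
rewrite -(mu_rotation i j 1%N _ ij mA); apply: le_measure; rewrite ?inE.
- exact: measurable_preimage_subgraph.
- exact: measurable_arm_event.
move=> g h; suff : arm_event P l (iter 1 (quarter_turn j i) 0) g.
  by rewrite /= quarter_turn0.
apply: (two_arms_preimage (hf := nearest_iter_quarter_turn j i 1)) => /=.
  exact: quarter_turn_inj.
apply: two_arms_sub h => y; rewrite /far /= quarter_turn0 !subr0 //.
by move/le_trans; apply; exact: quarter_turn_norm_ge.
Qed.

End Rotation.

(** A planar vector of sup norm at least [k] lies in one of four half-planes, which quarter turns
    permute; a union bound gives the 4. *)
Lemma mu_arm_event_right (R : realType) (mu : probability (subgraph_space 2) R)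
    (k l : nat) : rotation_invariant mu -> (0 < k)%N ->
  (mu (arm_event (far 0%R k) l 0%R) <=
   4%:R%:E * mu (arm_event [set y : lattice 2 | (k%:Z <= y 0 0)%R] l 0%R))%E.
Proof.
move=> mu_rotation k0; set P := [set y | _].
(* The successive preimages are the half-planes k <= y_1, k <= - y_0 and
   k <= - y_1. *)
pose P1 := quarter_turn 1 0 @^-1` P.
pose P2 := quarter_turn 1 0 @^-1` P1.
pose P3 := quarter_turn 1 0 @^-1` P2.
pose E (Q : set (lattice 2)) := arm_event Q l 0%R.
have mE Q : measurable (E Q) by exact: measurable_arm_event.
have rot Q : (mu (E (quarter_turn 1%R 0%R @^-1` Q)) <= mu (E Q))%E.
  exact: mu_arm_event_rotate.
have l1 : (mu (E P1) <= mu (E P))%E by exact: rot.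
have l2 : (mu (E P2) <= mu (E P))%E by apply: le_trans l1; exact: rot.
have l3 : (mu (E P3) <= mu (E P))%E by apply: le_trans l2; exact: rot.
apply: (@le_trans _ _ (mu ((E P `|` E P1) `|` (E P2 `|` E P3)))).
  apply: le_measure; rewrite ?inE; [exact: mE| |].
    by do ![apply: measurableU | exact: mE].
  move=> g [p1 [p2 [h1 h2 u + hl]]]; rewrite /far /= subr0.
  move=> /(lattice_norm_geP _ k0)[i ki].
  have arm Q : Q (last 0%R p1 - 0%R) -> E Q g by move=> Qp; exists p1, p2.
  move: ki; set y := last 0 p1 - 0; rewrite ler_normr => /orP ki.
  have qt (z : lattice 2) : (quarter_turn 1 0 z 0 0 = z 0 1) *
      (quarter_turn 1 0 z 0 1 = - z 0 0) by rewrite !mxE.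
  have i01 : i = 0 \/ i = 1.
    by case: (i) => -[|[|?]] // ?; [left|right]; exact: val_inj.
  case: i01 ki => ->{i} [ki|ki].
  - by left; left; exact: arm.
  - by right; left; apply: arm; rewrite /P2 /P1 /P /= !qt.
  - by left; right; apply: arm; rewrite /P1 /P /= !qt.
  - by right; right; apply: arm; rewrite /P3 /P2 /P1 /P /= !qt.
have -> : (4%:R%:E * mu (E P) =
    (mu (E P) + mu (E P)) + (mu (E P) + mu (E P)))%E.
  rewrite -(fineK (fin_num_measure mu _ (mE P))) -!EFinD -EFinM.
  by congr (_%:E); lra.
apply: le_trans (measureU2 _ _ _) _; [exact: measurableU|exact: measurableU|].
by apply: leeD; (apply: le_trans (measureU2 _ _ _) _; [exact: mE|exact: mE|]);
  exact: leeD.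
Qed.

(** The increments compare: [ln (n + 2) - ln (n + 1) = ln (1 + 1 / (n + 1)) <= 1 / (n + 1)]. *)
Lemma ln_le_harmonic (R : realType) (n : nat) :
  ln n.+1%:R <= \sum_(j < n) j.+1%:R^-1 :> R.
Proof.
elim: n => [|n IHn]; first by rewrite big_ord0 ln1.
rewrite big_ord_recr /=; have n0 : 0 < n.+1%:R :> R by rewrite ltr0n.
have -> : n.+2%:R = n.+1%:R * (1 + n.+1%:R^-1) :> R.
  by rewrite mulrDr mulr1 mulfV ?gt_eqF // -natr1.
have i0 : 0 < n.+1%:R^-1 :> R by rewrite invr_gt0.
rewrite lnM ?posrE ?addr_gt0 // lerD // le_ln1Dx //.
exact: lt_trans (ltrN10 _) i0.
Qed.

(** * The lower bounds of order [n] and [n log n] *)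

Section Lower_bounds.
Variables (R : realType) (d : nat) (mu : probability (subgraph_space d) R).
Implicit Types (x y v : lattice d) (g : subgraph d) (P : set (lattice d)).

Lemma far_trans x v (n : nat) y : `|x - v| <= n%:Z -> far x n.*2 y -> far v n y.
Proof.
rewrite /far /= => xn yx; rewrite -(lerD2r `|x - v|).
apply: (@le_trans _ _ `|y - x|); first by apply: le_trans yx; lia.
by rewrite (distrC x); exact: ler_distD.
Qed.

(** The condition on [P] takes the first arm out to radius [n]; the second reaches distance [2n]
    from [x], which is enough from any point inside the box. *)
Lemma arm_event_crossing P v (n : nat) x g :
  `|x - v| < n%:Z -> (forall y, P (y - x) -> n%:Z <= `|y - v|) ->
  arm_event P n.*2 x g -> exists2 e, crossing_edges g v n e & e x.
Proof.
move=> xn Pn; apply: two_arms_crossing => // y.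
exact: far_trans (ltW xn).
Qed.

Lemma expectation_ge (q : R) v (n : nat) :
  translation_invariant mu -> 0 < q ->
  (forall k l, k.+1%:R * q <=
     ((k.*2).*2.+1 ^ d)%:R * fine (mu (arm_event (far 0 k) l 0))) ->
  (0 < n)%N ->
  ((n%:R * q / 9 ^+ d)%:E <=
   'E_mu[fun g : subgraph_space d => (num_crossing_edges g v n)%:R])%E.
Proof.
move=> mu_translation q0 arm_ge; case: n => // m _; set n := m.+1.
(* The box of radius [m = n - 1] consists of the points strictly inside the box of radius [n]. *)
pose I := {ffun 'I_d -> 'I_m.*2.+1}.
pose f (h : I) : lattice d := box_point h + v.
have fv h : `|f h - v| < n%:Z.
  by rewrite addrK; apply: le_lt_trans (box_point_norm h) _; rewrite /n; lia.
have f_inj : injective f by move=> a b /addIr /box_point_inj.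
pose A (h : I) := arm_event (far 0 n.*2) n.*2 (f h).
have mA h : measurable (A h) by exact: measurable_arm_event.
have A_cross h g : A h g -> exists2 e, crossing_edges g v n e & e (f h).
  apply: arm_event_crossing => // y; rewrite /far /= subr0.
  exact: far_trans (ltW (fv h)).
apply: le_trans (expectation_crossing_edges_ge mu f_inj mA A_cross).
set p := fine (mu (arm_event (far 0 n.*2) n.*2 0)).
apply: (@le_trans _ _ (\sum_(h : I) (2^-1 * p)%:E)%E); last first.
  apply: lee_sum => h _; rewrite EFinM lee_pmul2l // /p fineK; last first.
    by apply: fin_num_measure; exact: measurable_arm_event.
  exact: mu_arm_event_translate.
rewrite sumEFin lee_fin sumr_const card_ffun !card_ord -[leRHS]mulr_natl.
have p0 : 0 <= p by exact: fine_ge0.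
have := arm_ge n.*2 n.*2; rewrite -/p => pge.
rewrite ler_pdivrMr ?exprn_gt0 //.
(* Source of the 9: taking [k = 2n] gives a box of side [8n + 1], the interior points form one of
   side [2n - 1], and [8n + 1 <= 9 (2n - 1)], with equality at [n = 1]. *)
have nat_le : ((n.*2.*2.*2.+1) ^ d <= 9 ^ d * m.*2.+1 ^ d)%N.
  have h9 : (n.*2.*2.*2.+1 <= 9 * m.*2.+1)%N by rewrite /n; lia.
  rewrite -expnMn.
  by have [->|d0] := posnP d; [rewrite !expn0 | rewrite leq_exp2r].
have : ((n.*2.*2.*2.+1) ^ d)%:R * p <= (9 ^ d * m.*2.+1 ^ d)%:R * p.
  by rewrite ler_wpM2r // ler_nat.
move=> /(le_trans pge); rewrite natrM natrX.
(* The factor [k + 1 = 2n + 1] absorbs the 2 lost to the two ends of an edge. *)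
have : 2 * (n%:R * q) <= (n.*2.+1)%:R * q.
  by rewrite mulrA ler_wpM2r ?(ltW q0) // -natrM ler_nat; lia.
move=> /le_trans /[apply]; set a := 9 ^+ d; set b := (_ ^ _)%:R.
rewrite (_ : b * (2^-1 * p) * a = 2^-1 * (a * b * p)); last first.
  by rewrite [LHS]mulrC mulrA mulrCA.
by rewrite ler_pdivlMl.
Qed.

End Lower_bounds.

(** The constant is [200 = 25 * 4 * 2]: [(4k + 1)^2 <= 25 k^2] for [k >= 1], four directions, two
    ends of an edge. *)
Lemma expectation_ge2 (R : realType) (mu : probability (subgraph_space 2) R)
    (q : R) (v : lattice 2) (n : nat) :
  translation_invariant mu -> rotation_invariant mu -> 0 < q ->
  (forall k l, k.+1%:R * q <=
     ((k.*2).*2.+1 ^ 2)%:R * fine (mu (arm_event (far 0 k) l 0))) ->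
  (0 < n)%N ->
  ((n%:R * ln n%:R * (q / 200))%:E <=
   'E_mu[fun g : subgraph_space 2 => (num_crossing_edges g v n)%:R])%E.
Proof.
move=> mu_translation mu_rotation q0 arm_ge n0.
pose I : finType := ('I_n * 'I_n)%type.
(* The first index counts columns from the right: the point is at distance [i.1 + 1] from the right
   side, and both coordinates stay between 0 and [n - 1]. *)
pose w (i : I) : lattice 2 :=
  \row_k (if k == 0 then n%:Z - 1 - (i.1 : nat)%:Z else (i.2 : nat)%:Z).
pose f (i : I) : lattice 2 := w i + v.
have w0 i : w i 0 0 = n%:Z - 1 - (i.1 : nat)%:Z by rewrite mxE.
have w1 i : w i 0 1 = (i.2 : nat)%:Z by rewrite mxE.
have w_inj : injective w.
  move=> [a b] [a' b'] e; have := w0 (a, b); have := w1 (a, b).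
  rewrite e w0 w1 /= => bb aa; congr pair; apply: val_inj => /=; lia.
have f_inj : injective f by move=> a b /addIr /w_inj.
have fv i : `|f i - v| < n%:Z.
  rewrite addrK; apply: (@le_lt_trans _ _ n.-1%:Z); last by lia.
  apply/lattice_norm_le => k; rewrite mxE.
  by have := ltn_ord i.1; have := ltn_ord i.2; case: ifP => _; lia.
pose P (k : nat) := [set y : lattice 2 | (k%:Z <= y 0 0)%R].
pose A (i : I) := arm_event (P i.1.+1) n.*2 (f i).
have mA i : measurable (A i) by exact: measurable_arm_event.
have A_cross i g : A i g -> exists2 e, crossing_edges g v n e & e (f i).
  apply: arm_event_crossing => // y; rewrite /P /= !mxE /= => h.
  apply: le_trans (lattice_norm_ge_coord _ 0); rewrite !mxE.
  have : n%:Z <= y 0 0 - v 0 0 by lia.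
  by move/le_trans; apply; exact: ler_norm.
apply: le_trans (expectation_crossing_edges_ge mu f_inj mA A_cross).
(* With [k = j + 1], the probability [p'] of a first arm in any direction satisfies
   [k q <= (k + 1) q <= 25 k^2 p']; going right costs a factor 4, which leaves [q / (100 k)]. *)
pose c (j : nat) : R := q / 100 / j.+1%:R.
apply: (@le_trans _ _ (\sum_(i : I) (2^-1 * c i.1)%:E)%E); last first.
  apply: lee_sum => i _; rewrite EFinM lee_pmul2l //.
  apply: le_trans (mu_arm_event_translate _ _ 0 _ mu_translation).
  set j := i.1 : nat; set p := mu _.
  have mP : measurable (arm_event (P j.+1) n.*2 0%R).
    exact: measurable_arm_event.
  rewrite -[p]fineK ?fin_num_measure // lee_fin.
  have := mu_arm_event_right n.*2 mu_rotation (ltn0Sn j).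
  rewrite -/(P j.+1) -/p -[p]fineK ?fin_num_measure // -EFinM.
  have mF : measurable (arm_event (far (0 : lattice 2) j.+1) n.*2 0%R).
    exact: measurable_arm_event.
  rewrite -[X in (X <= _)%E]fineK ?fin_num_measure // lee_fin.
  have := arm_ge j.+1 n.*2; set p' := fine _; set p1 := fine _ => h1 h2.
  have p'0 : 0 <= p' by exact: fine_ge0.
  have j0 : 0 < j.+1%:R :> R by rewrite ltr0n.
  rewrite /c ler_pdivrMr // ler_pdivrMr //.
  have : j.+1%:R * q <= (25 * j.+1 ^ 2)%:R * p'.
    apply: le_trans (le_trans h1 _).
      by rewrite ler_wpM2r ?(ltW q0) // ler_nat.
    by rewrite ler_wpM2r // ler_nat; nia.
  rewrite natrM natrX expr2 -!mulrA mulrCA ler_pM2l // => h3.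
  have : j.+1%:R * p' <= j.+1%:R * (4 * p1) by rewrite ler_wpM2l // ltW.
  by rewrite /= -/j; lra.
rewrite sumEFin lee_fin -mulr_sumr.
(* The summand depends on the column only, so each column contributes a factor [n] and a harmonic
   sum remains. *)
rewrite -(pair_bigA _ (fun a _ : 'I_n => c a)) /=.
under eq_bigr do rewrite sumr_const card_ord -mulr_natl.
rewrite -mulr_sumr /c -mulr_sumr.
have lnH := ln_le_harmonic R n.
have : ln n%:R <= ln n.+1%:R :> R by rewrite ler_ln ?posrE ?ltr0n // ler_nat.
move=> /le_trans /(_ lnH); set H := \sum_(_ < _) _ => hH.
rewrite (_ : 2^-1 * (n%:R * (q / 100 * H)) = n%:R * H * (q / 200)); last by lra.
rewrite ler_wpM2r //; first by rewrite divr_ge0 // ltW.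
by rewrite ler_wpM2l.
Qed.

Theorem theorem22 (R : realType) (d : nat)
    (mu : probability (subgraph_space d) R)
    (mu_tree : {ae mu, forall g, single_infinite_tree g})
    (mu_translation : translation_invariant mu)
    (mu_ergodic : ergodic mu)
    (mu_rotation : rotation_invariant mu) :
  exists2 rho : R, 0 < rho & forall v : lattice d,
    (\forall n \near \oo,
       ((rho * n%:R)%:E <
        'E_mu[fun g => (num_crossing_edges g v n)%:R])%E) /\
    (d = 2%N -> \forall n \near \oo,
       ((rho * (n%:R * ln n%:R))%:E <
        'E_mu[fun g => (num_crossing_edges g v n)%:R])%E).
Proof.
have F := ae_filter_ringOfSetsType mu.
have mu_conn : {ae mu, forall g,
    connected_graph g /\ infinite_set [set x | vset g x]}.
  by apply: filterS mu_tree => g [[gconn _] ginf _ _].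
have mu_nonempty : {ae mu, forall g, exists x, vset g x}.
  by apply: filterS mu_tree => g [[[gne _] _] _ _ _].
pose q := fine (mu [set g : subgraph_space d | vset (g : subgraph d) 0]).
have qE : q%:E = mu [set g : subgraph_space d | vset (g : subgraph d) 0].
  by rewrite fineK // fin_num_measure //; exact: measurable_vset.
have q0 : 0 < q by rewrite -lte_fin qE; exact: vset_prob_gt0.
have arm_ge k l : k.+1%:R * q <=
    ((k.*2).*2.+1 ^ d)%:R * fine (mu (arm_event (far 0 k) l 0)).
  have := arm_event_prob_ge k l mu_translation mu_conn; rewrite -qE.
  rewrite -[X in (_ <= _ * X)%E]fineK; first by rewrite -!EFinM lee_fin.
  by rewrite fin_num_measure //; exact: measurable_arm_event.
have c1_gt0 : 0 < q / 9 ^+ d by rewrite divr_gt0 // exprn_gt0.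
have c2_gt0 : 0 < q / 200 by lra.
have bound1 v n := @expectation_ge R d mu q v n mu_translation q0 arm_ge.
have bound2 (d2 : d = 2%N) v n : (0 < n)%N ->
    ((n%:R * ln n%:R * (q / 200))%:E <=
     'E_mu[fun g : subgraph_space d => (num_crossing_edges g v n)%:R])%E.
  by subst d; exact: expectation_ge2.
move: (q / 200) c2_gt0 bound2 => c2 c2_gt0 bound2.
(* Halving the minimum of the two constants makes the final inequalities strict. *)
have [c c_gt0 [c_lt1 c_lt2]] : exists2 c, 0 < c & c < q / 9 ^+ d /\ c < c2.
  exists (Num.min (q / 9 ^+ d) c2 / 2).
    by rewrite divr_gt0 ?lt_min ?c1_gt0.
  have : Num.min (q / 9 ^+ d) c2 <= q / 9 ^+ d by rewrite ge_min lexx.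
  have : Num.min (q / 9 ^+ d) c2 <= c2 by rewrite ge_min lexx orbT.
  by lra.
exists c => // v; split=> [|d2].
  exists 1%N => // n /= n0; apply: lt_le_trans (bound1 v n n0).
  by rewrite lte_fin -mulrA mulrC ltr_pM2l ?ltr0n.
(* From [n = 2] on the logarithm is positive, so a smaller constant gives a strictly smaller
   bound. *)
exists 2%N => // n /= n2; apply: lt_le_trans (bound2 d2 v n (ltnW n2)).
rewrite lte_fin mulrC ltr_pM2l // mulr_gt0 ?ltr0n ?(ltnW n2) //.
by rewrite ln_gt0 // ltr1n.
Qed.
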